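(* Let $\mathcal{I}$ be a finite category. Then Leinster's Euler characteristic $\chi_L(\mathrm{Sd}(\mathcal{I}))$ of the barycentric subdivision of $\mathcal{I}$ exists if and only if $\mathcal{I}$ is acyclic, in which case $$\chi_L(\mathcal{I})=\chi_L(\mathrm{Sd}(\mathcal{I})).$$
   Context: A small category is acyclic if all its endomorphisms are identities and, whenever there is a morphism $X\to Y$ with $X\neq Y$, there is no morphism $Y\to X$. A finite category has finitely many objects and morphisms. Leinster's Euler characteristic is defined only for finite categories. For a finite category $\mathcal{I}$ with objects $x_1,\dots,x_n$, let $Z_{\mathcal{I}}$ be the $n\times n$ matrix whose $(i,j)$-entry is the number of morphisms from $x_i$ to $x_j$. A weighting on $\mathcal{I}$ is a row vector $\mathbf{w}=(w_1,\dots,w_n)\in\mathbb{Q}^n$ with $Z_{\mathcal{I}}\,{}^{t}\mathbf{w}={}^{t}(1,\dots,1)$; a coweighting is $\mathbf{c}\in\mathbb{Q}^n$ with $\mathbf{c}Z_{\mathcal{I}}=(1,\dots,1)$. If $\mathcal{I}$ has both a weighting $\mathbf{w}$ and a coweighting, then $\chi_L(\mathcal{I})=\sum_{i=1}^n w_i$; otherwise $\chi_L(\mathcal{I})$ does not exist. Barycentric subdivision. For a natural number $n\ge 0$, $[n]=\{0,1,\dots,n\}$ is the poset with the usual order. For a small category $\mathcal{J}$, $\overline{N_n}(\mathcal{J})$ is the set of non-degenerate chains $x_0\xrightarrow{f_1}x_1\to\cdots\xrightarrow{f_n}x_n$ in $\mathcal{J}$, i.e. functors $[n]\to\mathcal{J}$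 for which no $f_i$ is an identity, with $\overline{N_0}(\mathcal{J})=\mathrm{Ob}(\mathcal{J})$. $\mathrm{Sd}(\mathcal{J})$ is the small category whose set of objects is $\coprod_{n\ge0}\overline{N_n}(\mathcal{J})$. An object $X$ of length $q_X$ is regarded as a functor $X:[q_X]\to\mathcal{J}$. The set of morphisms from $X$ to $Y$ is the quotient of the set of order-preserving maps $f:[q_X]\to[q_Y]$ with $Y\circ f=X$ by the equivalence relation generated by: $f\sim g$ if for every $0\le i\le q_X$ the morphism $Y(\min\{f(i),g(i)\}\to\max\{f(i),g(i)\})$ is an identity. Composition is induced by composition of order-preserving maps. *)

(* Defs.v *)
From Stdlib Require Import Relation_Operators.
From HB Require Import structures.
From mathcomp Require Import all_boot all_order all_algebra.
From mathcomp Require Import boolp classical_sets cardinality.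

Set Implicit Arguments.
Unset Strict Implicit.
Unset Printing Implicit Defensive.

Import Order.TTheory GRing.Theory Num.Theory.

Declare Scope cat_scope.
Delimit Scope cat_scope with cat.
Local Open Scope quotient_scope.
Local Open Scope cat_scope.

(* Composition is written in diagrammatic order: [f ;; g] is "f, then g". *)
Record category := Category {
  obj :> Type;
  mor : obj -> obj -> Type;
  idm : forall x, mor x x;
  compm : forall x y z, mor x y -> mor y z -> mor x z;
  comp1m : forall x y (f : mor x y), compm (idm x) f = f;
  compm1 : forall x y (f : mor x y), compm f (idm y) = f;
  compmA : forall x y z t (f : mor x y) (g : mor y z) (h : mor z t),
    compm f (compm g h) = compm (compm f g) h }.

Arguments idm {C} x : rename.
Arguments compm {C x y z} f g : rename.
Notation "f ;; g" := (compm f g) (at level 50, left associativity) : cat_scope.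

(* [is_identity f] may hold only when the endpoints of [f] are equal; stating it
   inductively avoids transporting [f] along that equality. *)
Inductive is_identity (C : category) : forall x y : C, mor x y -> Prop :=
  IsIdentity (x : C) : is_identity (idm x).

Record functor (C D : category) := Functor {
  fobj :> C -> D;
  fmap : forall x y : C, mor x y -> mor (fobj x) (fobj y);
  fmap_id : forall x : C, fmap (idm x) = idm (fobj x);
  fmap_comp : forall (x y z : C) (f : mor x y) (g : mor y z),
    fmap (f ;; g) = fmap f ;; fmap g }.

Definition functor_id (C : category) : functor C C :=
  @Functor C C (fun x => x) (fun x y f => f)
    (fun x => erefl) (fun x y z f g => erefl).

Lemma functor_comp_id (C D E : category) (F : functor C D) (G : functor D E)
  (x : C) : fmap G (fmap F (idm x)) = idm (G (F x)).
Proof. by rewrite !fmap_id. Qed.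

Lemma functor_comp_comp (C D E : category) (F : functor C D) (G : functor D E)
  (x y z : C) (f : mor x y) (g : mor y z) :
  fmap G (fmap F (f ;; g)) = fmap G (fmap F f) ;; fmap G (fmap F g).
Proof. by rewrite !fmap_comp. Qed.

Definition functor_comp (C D E : category) (G : functor D E) (F : functor C D) :
    functor C E :=
  @Functor C E (fun x => G (F x)) (fun x y f => fmap G (fmap F f))
    (@functor_comp_id C D E F G) (@functor_comp_comp C D E F G).

Lemma functor_comp1 (C D : category) (F : functor C D) :
  functor_comp F (functor_id C) = F.
Proof.
case: F => F0 F1 Fi Fc; rewrite /functor_comp /=.
by congr Functor; exact: Prop_irrelevance.
Qed.

Lemma functor_compA (B C D E : category)
  (F : functor B C) (G : functor C D) (H : functor D E) :
  functor_comp (functor_comp H G) F = functor_comp H (functor_comp G F).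
Proof.
by rewrite /functor_comp /=; congr Functor; exact: Prop_irrelevance.
Qed.

Definition acyclic (C : category) : Prop :=
  (forall (x : C) (f : mor x x), f = idm x) /\
  (forall x y : C, x <> y -> mor x y -> ~ inhabited (mor y x)).

Definition arrow (C : category) : Type := {x : C & {y : C & mor x y}}.

Definition finite_category (C : category) : Prop :=
  finite_set [set: obj C] /\ finite_set [set: arrow C].

(* The number of elements of [T]; the value is 0 when [T] is infinite. *)
Definition ncard (T : Type) : nat :=
  xget 0%N [set n | ([set: T] #= `I_n)%card]%classic.

Definition mor_matrix (C : category) (n : nat) (x : 'I_n -> C) : 'M[rat]_n :=
  (\matrix_(i, j) (ncard (mor (x i) (x j)))%:R)%R.

Definition weighting (C : category) (n : nat) (x : 'I_n -> C)
    (w : 'rV[rat]_n) : Prop :=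
  (mor_matrix x *m w^T = const_mx 1)%R.

Definition coweighting (C : category) (n : nat) (x : 'I_n -> C)
    (c : 'rV[rat]_n) : Prop :=
  (c *m mor_matrix x = const_mx 1)%R.

Definition has_euler_char (C : category) (q : rat) : Prop :=
  finite_category C /\
  exists (n : nat) (x : 'I_n -> C) (w c : 'rV[rat]_n),
    [/\ bijective x, weighting x w, coweighting x c &
        q = (\sum_(i < n) w ord0 i)%R].

Lemma weighting_sum (C : category) (n m : nat) (x : 'I_n -> C) (y : 'I_m -> C)
    (w : 'rV[rat]_n) (c : 'rV[rat]_m) :
  bijective x -> bijective y -> weighting x w -> coweighting y c ->
  (\sum_(i < n) w ord0 i = \sum_(j < m) c ord0 j)%R.
Proof.
move=> [x' xK x'K] [y' yK y'K] hw hc.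
have hwE (z : C) : (\sum_(i < n) (ncard (mor z (x i)))%:R * w ord0 i = 1 :> rat)%R.
  move/matrixP/(_ (x' z) ord0): hw; rewrite !mxE => hwz; rewrite -[RHS]hwz.
  by apply: eq_bigr => i _; rewrite !mxE x'K.
have hcE (z : C) : (\sum_(j < m) c ord0 j * (ncard (mor (y j) z))%:R = 1 :> rat)%R.
  move/matrixP/(_ ord0 (y' z)): hc; rewrite !mxE => hcz; rewrite -[RHS]hcz.
  by apply: eq_bigr => j _; rewrite !mxE y'K.
transitivity (\sum_(i < n) \sum_(j < m)
    c ord0 j * (ncard (mor (y j) (x i)))%:R * w ord0 i)%R.
  by apply: eq_bigr => i _; rewrite -mulr_suml hcE mul1r.
rewrite exchange_big /=; apply: eq_bigr => j _.
by under eq_bigr => i _ do rewrite -mulrA; rewrite -mulr_sumr hwE mulr1.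
Qed.

(* The sum of the entries does not depend on the weighting, nor on the
   enumeration of the objects. *)
Lemma has_euler_char_uniq (C : category) (p q : rat) :
  has_euler_char C p -> has_euler_char C q -> p = q.
Proof.
move=> [_ [n [x [w [c [bx hw hc ->]]]]]] [_ [m [y [v [d [by_ hv hd ->]]]]]].
by rewrite (weighting_sum bx bx hw hc) -(weighting_sum by_ bx hv hc).
Qed.

(* [None] when the Euler characteristic does not exist. *)
Definition chiL (C : category) : option rat :=
  if pselect (exists q, has_euler_char C q) is left h
  then Some (projT1 (cid h)) else None.

Definition chiL_exists (C : category) : Prop := exists q, chiL C = Some q.

Lemma chiLP (C : category) (q : rat) : chiL C = Some q <-> has_euler_char C q.
Proof.
rewrite /chiL; case: pselect => [h|nh]; last first.
  by split=> // hq; case: nh; exists q.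
case: cid => p hp /=; split=> [[<-] //|hq].
by rewrite (has_euler_char_uniq hp hq).
Qed.

Lemma poset_irr d (P : porderType d) (x y : P) (f g : (x <= y)%O) : f = g.
Proof. exact: bool_irrelevance. Qed.

Definition poset_cat d (P : porderType d) : category :=
  @Category P (fun x y => (x <= y)%O) (fun x => lexx x)
    (fun x y z f g => le_trans f g)
    (fun x y f => poset_irr _ _) (fun x y f => poset_irr _ _)
    (fun x y z t f g h => poset_irr _ _).

Lemma functor_poset_eq (C : category) d (P : porderType d)
    (F G : functor C (poset_cat P)) : (forall x, F x = G x) -> F = G.
Proof.
case: F G => F0 F1 Fi Fc [G0 G1 Gi Gc] /= /funext FG.
case: _ / FG in G1 Gi Gc *.
have FG1 : F1 = G1.
  by do 3!apply: functional_extensionality_dep => ?; exact: poset_irr.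
by case: _ / FG1 in Gi Gc *; congr Functor; exact: Prop_irrelevance.
Qed.

Lemma is_identity_poset (C : category) d (P : porderType d)
    (F : functor (poset_cat P) C) (x y x' y' : poset_cat P)
    (f : mor x y) (g : mor x' y') :
  x = x' -> y = y' -> is_identity (fmap F f) -> is_identity (fmap F g).
Proof.
by move=> xx' yy'; case: _ / xx' in g *; case: _ / yy' in g *; rewrite (poset_irr f g).
Qed.

(* The poset [n] = {0 <= 1 <= ... <= n}. *)
Definition simplex (n : nat) : category := poset_cat 'I_n.+1.

Definition monotone (m n : nat) (f : 'I_m.+1 -> 'I_n.+1) : Prop :=
  {homo f : i j / (i <= j)%O}.

Definition simplex_functor (m n : nat) (f : 'I_m.+1 -> 'I_n.+1)
    (hf : monotone f) : functor (simplex m) (simplex n) :=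
  @Functor (simplex m) (simplex n) f (fun i j h => hf i j h)
    (fun i => poset_irr _ _) (fun i j k g h => poset_irr _ _).

Definition nondegenerate (J : category) (n : nat) (X : functor (simplex n) J) :
    Prop :=
  forall (i j : simplex n) (h : mor i j),
    (j : 'I_n.+1) = (i : 'I_n.+1).+1 :> nat -> ~ is_identity (fmap X h).

Record sd_obj (J : category) := SdObj {
  len : nat;
  chain :> functor (simplex len) J;
  chain_nondeg : nondegenerate chain }.

Definition is_sd_map (J : category) (X Y : sd_obj J)
    (f : {ffun 'I_(len X).+1 -> 'I_(len Y).+1}) : Prop :=
  exists hf : monotone f, functor_comp Y (simplex_functor hf) = X.

Definition sd_map (J : category) (X Y : sd_obj J) :=
  {f : {ffun 'I_(len X).+1 -> 'I_(len Y).+1} | `[< is_sd_map f >]}.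

Lemma le_minmax (n : nat) (i j : 'I_n) : (Order.min i j <= Order.max i j)%O.
Proof. by rewrite ge_min !le_max !lexx. Qed.

Definition sd_step (J : category) (X Y : sd_obj J) (f g : sd_map X Y) : Prop :=
  forall i, is_identity
    (@fmap _ _ Y (Order.min (val f i) (val g i)) (Order.max (val f i) (val g i))
       (le_minmax (val f i) (val g i))).

Definition sd_equiv (J : category) (X Y : sd_obj J) : rel (sd_map X Y) :=
  fun f g => `[< clos_refl_sym_trans _ (@sd_step J X Y) f g >].

Lemma sd_equiv_refl (J : category) (X Y : sd_obj J) : reflexive (@sd_equiv J X Y).
Proof. by move=> f; apply/asboolP; apply: rst_refl. Qed.

Lemma sd_equiv_sym (J : category) (X Y : sd_obj J) : symmetric (@sd_equiv J X Y).
Proof. by move=> f g; apply/asboolP/asboolP; apply: rst_sym. Qed.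

Lemma sd_equiv_trans (J : category) (X Y : sd_obj J) :
  transitive (@sd_equiv J X Y).
Proof.
by move=> g f h /asboolP fg /asboolP gh; apply/asboolP; apply: rst_trans fg gh.
Qed.

Canonical sd_equiv_rel (J : category) (X Y : sd_obj J) :=
  EquivRel (@sd_equiv J X Y) (@sd_equiv_refl J X Y) (@sd_equiv_sym J X Y)
    (@sd_equiv_trans J X Y).

Definition sd_mor (J : category) (X Y : sd_obj J) : Type :=
  {eq_quot (sd_equiv_rel X Y)}.

Definition sd_class (J : category) (X Y : sd_obj J) (f : sd_map X Y) :
    sd_mor X Y :=
  \pi_{eq_quot (sd_equiv_rel X Y)} f.

Definition sd_rep (J : category) (X Y : sd_obj J) (f : sd_mor X Y) : sd_map X Y :=
  repr (f : {eq_quot (sd_equiv_rel X Y)}).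

Lemma is_sd_map_id (J : category) (X : sd_obj J) :
  `[< @is_sd_map J X X [ffun i => i] >].
Proof.
apply/asboolP.
have hf : monotone ([ffun i => i] : {ffun 'I_(len X).+1 -> 'I_(len X).+1}).
  by move=> i j; rewrite !ffunE.
exists hf; rewrite -[RHS]functor_comp1; congr functor_comp.
by apply: functor_poset_eq => i /=; rewrite ffunE.
Qed.

Definition sd_map_id (J : category) (X : sd_obj J) : sd_map X X :=
  exist _ [ffun i => i] (is_sd_map_id X).

Lemma is_sd_map_comp (J : category) (X Y Z : sd_obj J)
    (f : sd_map X Y) (g : sd_map Y Z) :
  `[< @is_sd_map J X Z [ffun i => val g (val f i)] >].
Proof.
case: f g => f /= /asboolP[hf Yf] [g /= /asboolP[hg Zg]]; apply/asboolP.
have hgf : monotone [ffun i => g (f i)].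
  by move=> i j ij; rewrite !ffunE; exact/(hg _ _)/(hf _ _ ij).
exists hgf; rewrite -Yf -Zg functor_compA; congr functor_comp.
by apply: functor_poset_eq => i /=; rewrite ffunE.
Qed.

Definition sd_map_comp (J : category) (X Y Z : sd_obj J)
    (f : sd_map X Y) (g : sd_map Y Z) : sd_map X Z :=
  exist _ [ffun i => val g (val f i)] (is_sd_map_comp f g).

Lemma sd_step_compl (J : category) (X Y Z : sd_obj J)
    (f : sd_map X Y) (g g' : sd_map Y Z) :
  sd_step g g' -> sd_step (sd_map_comp f g) (sd_map_comp f g').
Proof.
move=> gg' i; move: (gg' (val f i)).
by apply: is_identity_poset; rewrite /= !ffunE.
Qed.

Lemma sd_step_compr (J : category) (X Y Z : sd_obj J)
    (f f' : sd_map X Y) (g : sd_map Y Z) :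
  sd_step f f' -> sd_step (sd_map_comp f g) (sd_map_comp f' g).
Proof.
move=> ff' i; have [hg Zg] := asboolW (valP g).
move: (ff' i); rewrite -Zg /=; apply: is_identity_poset; rewrite /= !ffunE.
  case: (leP (val f i) (val f' i)) => [|/ltW] le.
    by rewrite min_l ?hg.
  by rewrite min_r ?hg.
case: (leP (val f i) (val f' i)) => [|/ltW] le.
  by rewrite max_r ?hg.
by rewrite max_l ?hg.
Qed.

Lemma sd_equiv_comp (J : category) (X Y Z : sd_obj J)
    (f f' : sd_map X Y) (g g' : sd_map Y Z) :
  sd_equiv f f' -> sd_equiv g g' ->
  sd_equiv (sd_map_comp f g) (sd_map_comp f' g').
Proof.
move=> /asboolP ff' /asboolP gg'; apply/asboolP.
apply: (@rst_trans _ _ _ (sd_map_comp f' g)).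
- elim: ff' => [h k hk|h|h k _|h k l _ hk _ kl].
  + by apply: rst_step; exact: sd_step_compr.
  + exact: rst_refl.
  + exact: rst_sym.
  + exact: rst_trans hk kl.
- elim: gg' => [h k hk|h|h k _|h k l _ hk _ kl].
  + by apply: rst_step; exact: sd_step_compl.
  + exact: rst_refl.
  + exact: rst_sym.
  + exact: rst_trans hk kl.
Qed.

Lemma sd_classP (J : category) (X Y : sd_obj J) (f g : sd_map X Y) :
  sd_class f = sd_class g <-> sd_equiv f g.
Proof. by split=> [/eqquotP|fg]; [|apply/eqquotP]. Qed.

Lemma sd_repK (J : category) (X Y : sd_obj J) (f : sd_mor X Y) :
  sd_class (sd_rep f) = f.
Proof. exact: reprK. Qed.

Definition sd_id (J : category) (X : sd_obj J) : sd_mor X X :=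
  sd_class (sd_map_id X).

Definition sd_comp (J : category) (X Y Z : sd_obj J)
    (f : sd_mor X Y) (g : sd_mor Y Z) : sd_mor X Z :=
  sd_class (sd_map_comp (sd_rep f) (sd_rep g)).

Lemma sd_comp_class (J : category) (X Y Z : sd_obj J)
    (f : sd_map X Y) (g : sd_map Y Z) :
  sd_comp (sd_class f) (sd_class g) = sd_class (sd_map_comp f g).
Proof.
by apply/sd_classP/sd_equiv_comp; apply/sd_classP; exact: sd_repK.
Qed.

Lemma sd_comp1m (J : category) (X Y : sd_obj J) (f : sd_mor X Y) :
  sd_comp (sd_id X) f = f.
Proof.
rewrite -[f]sd_repK sd_comp_class; congr sd_class.
by apply: val_inj; apply/ffunP => i /=; rewrite !ffunE.
Qed.

Lemma sd_compm1 (J : category) (X Y : sd_obj J) (f : sd_mor X Y) :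
  sd_comp f (sd_id Y) = f.
Proof.
rewrite -[f]sd_repK sd_comp_class; congr sd_class.
by apply: val_inj; apply/ffunP => i /=; rewrite !ffunE.
Qed.

Lemma sd_compmA (J : category) (X Y Z T : sd_obj J)
    (f : sd_mor X Y) (g : sd_mor Y Z) (h : sd_mor Z T) :
  sd_comp f (sd_comp g h) = sd_comp (sd_comp f g) h.
Proof.
rewrite -[f]sd_repK -[g]sd_repK -[h]sd_repK !sd_comp_class; congr sd_class.
by apply: val_inj; apply/ffunP => i /=; rewrite !ffunE.
Qed.

Definition Sd (J : category) : category :=
  @Category (sd_obj J) (@sd_mor J) (@sd_id J) (@sd_comp J)
    (@sd_comp1m J) (@sd_compm1 J) (@sd_compmA J).

(* Main.v *)
From mathcomp Require Import all_boot all_order all_algebra.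
From mathcomp Require Import boolp classical_sets cardinality.
Require Import Defs.

Set Implicit Arguments.
Unset Strict Implicit.
Unset Printing Implicit Defensive.

Import Order.TTheory GRing.Theory Num.Theory.

Local Open Scope cat_scope.

(** Write [s X] for [(-1) ^+ len X], the sign of a chain [X].

    If [Sd I] has an Euler characteristic, it is a finite category, so [I] has
    finitely many nondegenerate chains. A non-identity endomorphism, or a pair
    of arrows in opposite directions between two distinct objects, could be
    iterated into nondegenerate chains of every length; hence [I] is acyclic
    ([finite_sd_acyclic]).

    Suppose conversely that [I] is acyclic. The objects along a nondegenerate
    chain are then pairwise distinct, so chains are bounded in length and there
    are finitely many of them, and an order-preserving map [X -> Y] over [I] is
    determined by the values of [X] and [Y]. Thus [Sd I] is a finite poset: its
    objects are the chains of [I], ordered by being a subchain, and the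
    equivalence relation on maps identifies nothing new. The Euler
    characteristics of [I] and of [Sd I] are both the alternating number of
    chains, the sum of [s X] over all [X]:

    - The subchains of [Y] correspond to the nonempty subsets of its vertices
      ([subchain_inj], [subchainP]), and the alternating number of nonempty
      subsets of a nonempty set is 1. This says that [s] is a coweighting on
      [Sd I] ([sum_sign_below]).
    - Let [w x] be the sum of [s X] over the chains that start at [x]. Such a
      chain is either the point [x], or a non-identity arrow out of [x] followed
      by a shorter chain; as prefixing an arrow changes the sign, [w x] is 1
      minus the sum over non-identity arrows [x -> y] of [w y]. This says that
      [w] is a weighting on [I] ([chain_weightP]).

    Only one of the two sides has been exhibited in each case. The other one
    exists because the zeta matrix of a finite acyclic category is invertible
    ([mor_matrix_unit]), and it has the same sum ([weighting_sum]). *)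

(** * Finite types *)

Definition finite_type (A : Type) : Prop := finite_set [set: A].

Lemma finite_type_enum (A : Type) (finA : finite_type A) :
  exists n (f : A -> 'I_n) (g : 'I_n -> option A), pcancel f g.
Proof.
case: finA => n /card_set_bijP[f] [fI finj _].
have ltf (a : A) : (f a < n)%N by apply: (fI a).
exists n, (fun a => Ordinal (ltf a)), (fun i : 'I_n =>
  if pselect (exists b, f b = i :> nat) is left h then Some (projT1 (cid h)) else None).
move=> a /=; case: pselect => [h|[]]; last by exists a.
by congr Some; case: cid => b /= fba; apply: finj; rewrite ?inE.
Qed.

(** The carrier is convertible to [A], so that functions and predicates on [A]
    can be summed over [finT finA] as they are. *)
Definition finT (A : Type) (finA : finite_type A) : finType :=
  let f := cid (projT2 (cid (finite_type_enum finA))) in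
  pcan_type (projT2 (cid (projT2 f))).

Lemma finite_type_fin (T : finType) : finite_type T.
Proof. exact: finite_finset. Qed.

Lemma finite_type_inj (A B : Type) (f : A -> B) :
  injective f -> finite_type B -> finite_type A.
Proof.
move=> finj finB; apply: (@card_le_finite _ _ _ [set: B]) => //.
have [|g] := (injfunPex (A := [set: A]) (B := [set: B])).2; last exact: inj_card_le.
by exists f => // x y _ _ /finj.
Qed.

Lemma finite_type_surj (A B : Type) (f : A -> B) :
  (forall b, exists a, f a = b) -> finite_type A -> finite_type B.
Proof.
move=> fsurj /(finite_image f); apply: sub_finite_set => b _.
by have [a <-] := fsurj b; exists a.
Qed.

Lemma card_finT (A : Type) (finA : finite_type A) : #|finT finA| = ncard A.
Proof.
have cardA : ([set: A] #= `I_#|finT finA|)%card.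
  apply/card_set_bijP; exists (fun a : finT finA => enum_rank a : nat); split.
  - by move=> a _ /=; exact: ltn_ord.
  - by move=> a b _ _ /val_inj/enum_rank_inj.
  - by move=> i /= lti; exists (enum_val (Ordinal lti)) => //; rewrite enum_valK.
apply/esym/card_eq_II; rewrite /ncard.
case: xgetP => [n -> /= An|]; last by move/(_ #|finT finA|).
by rewrite -(card_eql An).
Qed.

(** * Equality of functors and chains *)

Lemma existT_inj (A : Type) (P : A -> Type) (a : A) (p q : P a) :
  existT P a p = existT P a q -> p = q.
Proof.
move=> e; pose g (u : {x & P x}) (h : projT1 u = a) : P a :=
  eq_rect _ P (projT2 u) _ h.
have: forall u (e : existT P a p = u) (h : projT1 u = a), p = g u h.
  by move=> u <- h; rewrite /g (Prop_irrelevance h erefl).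
by move=> /(_ _ e erefl).
Qed.

(** Arrows with different endpoints are compared in [arrow C]: equations between
    values of two functors then need no transport. *)
Definition to_arrow (C : category) (x y : C) (f : mor x y) : arrow C :=
  existT _ x (existT _ y f).

Lemma to_arrow_inj (C : category) (x y : C) : injective (@to_arrow C x y).
Proof. by move=> f g e; exact: existT_inj (existT_inj e). Qed.

Lemma is_identity_arrow (C : category) (x y x' y' : C) (f : mor x y)
    (g : mor x' y') : to_arrow f = to_arrow g -> is_identity f -> is_identity g.
Proof.
pose P (a : arrow C) := is_identity (projT2 (projT2 a)).
by move=> e; rewrite -[is_identity f]/(P (to_arrow f)) e.
Qed.

Lemma is_identity_end (C : category) (x y : C) (f : mor x y) :
  is_identity f -> x = y.
Proof. by case. Qed.

Lemma is_identityE (C : category) (x y : C) (f : mor x y) :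
  is_identity f -> to_arrow f = to_arrow (idm x).
Proof. by case. Qed.

Lemma functor_ext (C D : category) (F G : functor C D) :
  (forall x y (f : mor x y), to_arrow (fmap F f) = to_arrow (fmap G f)) -> F = G.
Proof.
move=> FG; have FG0 : fobj F = fobj G.
  by apply/funext => x; exact: (congr1 (@projT1 _ _) (FG _ _ (idm x))).
case: F G FG0 FG => F0 F1 Fi Fc [G0 G1 Gi Gc] /= FG0.
case: _ / FG0 in G1 Gi Gc * => FG.
have FG1 : F1 = G1.
  by do 3!apply: functional_extensionality_dep => ?; exact/to_arrow_inj/FG.
by case: _ / FG1 in Gi Gc FG *; congr Functor; exact: Prop_irrelevance.
Qed.

(** [i] and [i'] may be provably equal without being convertible, typically two
    ordinals with different bound proofs. *)
Lemma to_arrow_chain (J : category) n (X : functor (simplex n) J)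
    (i j i' j' : simplex n) (h : mor i j) (h' : mor i' j') :
  i = i' :> 'I_n.+1 -> j = j' :> 'I_n.+1 ->
  to_arrow (fmap X h) = to_arrow (fmap X h').
Proof.
move=> ii' jj'; case: _ / ii' in h' *; case: _ / jj' in h' *.
by rewrite (poset_irr h h').
Qed.

Lemma sd_obj_eq (J : category) n (F G : functor (simplex n) J)
    (nF : nondegenerate F) (nG : nondegenerate G) :
  F = G -> SdObj nF = SdObj nG.
Proof. by move=> FG; case: _ / FG in nG *; congr SdObj; exact: Prop_irrelevance. Qed.

Lemma sd_obj_inj (J : category) n (F G : functor (simplex n) J)
    (nF : nondegenerate F) (nG : nondegenerate G) :
  SdObj nF = SdObj nG -> F = G.
Proof.
pose T := {m & functor (simplex m) J}.
move=> /(congr1 (fun X : sd_obj J => existT _ (len X) (chain X) : T)).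
exact: existT_inj.
Qed.

Definition source (J : category) (X : sd_obj J) : J := X ord0.

(** * Chains of length 0 *)

Definition point_functor (J : category) (x : J) : functor (simplex 0) J :=
  @Functor (simplex 0) J (fun _ => x) (fun _ _ _ => idm x)
    (fun _ => erefl) (fun _ _ _ _ _ => esym (comp1m (idm x))).

Lemma point_nondeg (J : category) (x : J) : nondegenerate (point_functor x).
Proof. by move=> i [[|j] hj]. Qed.

Definition point (J : category) (x : J) : sd_obj J := SdObj (@point_nondeg J x).

Lemma len0_point (J : category) (X : sd_obj J) :
  len X = 0 -> X = point (source X).
Proof.
case: X => n F nF /= n0; case: _ / (esym n0) in F nF *.
apply: sd_obj_eq; apply: functor_ext => i j h /=.
by rewrite (@to_arrow_chain _ _ _ _ _ ord0 ord0 h (lexx _)) ?[LHS]ord1 // fmap_id.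
Qed.

(** * Adding an arrow in front of a chain *)

Section Cons.
Context (J : category) (n : nat) (X : functor (simplex n) J) (x : J).
Context (f : mor x (X ord0)).

Definition cons_obj (i : 'I_n.+2) : J :=
  match i with
  | Ordinal 0 _ => x
  | Ordinal k.+1 h => X (@Ordinal n.+1 k h)
  end.

Definition cons_mor (i j : 'I_n.+2) : (i <= j)%O -> mor (cons_obj i) (cons_obj j) :=
  match i, j return (i <= j)%O -> mor (cons_obj i) (cons_obj j) with
  | Ordinal 0 _, Ordinal 0 _ => fun _ => idm x
  | Ordinal 0 _, Ordinal l.+1 hl =>
      fun _ => f ;; @fmap _ _ X (ord0 : 'I_n.+1) (@Ordinal n.+1 l hl) (leq0n l)
  | Ordinal k.+1 hk, Ordinal 0 _ => fun h => match notF h with end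
  | Ordinal k.+1 hk, Ordinal l.+1 hl =>
      fun h => @fmap _ _ X (@Ordinal n.+1 k hk) (@Ordinal n.+1 l hl) h
  end.

Lemma cons_mor_id (i : simplex n.+1) : cons_mor (idm i) = idm (cons_obj i).
Proof.
case: i => -[|k] hk //=; rewrite -[RHS]fmap_id; congr fmap; exact: poset_irr.
Qed.

Lemma cons_mor_comp (i j k : simplex n.+1) (g : mor i j) (h : mor j k) :
  cons_mor (g ;; h) = cons_mor g ;; cons_mor h.
Proof.
case: i j k g h => -[|i] hi [[|j] hj] [[|k] hk] g h //=.
- by rewrite comp1m.
- by rewrite comp1m.
- by rewrite -compmA -fmap_comp; congr (_ ;; fmap _ _); exact: poset_irr.
- by rewrite -fmap_comp; congr fmap; exact: poset_irr.
Qed.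

Definition cons_functor : functor (simplex n.+1) J :=
  @Functor (simplex n.+1) J cons_obj cons_mor cons_mor_id cons_mor_comp.

Lemma to_arrow_cons0 (k : simplex n) (h : @mor (simplex n) ord0 k) :
  ord0 = k :> 'I_n.+1 -> to_arrow (f ;; fmap X h) = to_arrow f.
Proof.
move=> k0; case: _ / k0 in h *.
have -> : h = @idm (simplex n) ord0 by exact: poset_irr.
by rewrite fmap_id compm1.
Qed.

Lemma cons_nondeg :
  nondegenerate X -> ~ is_identity f -> nondegenerate cons_functor.
Proof.
move=> nX nf [[|i] hi] [[|j] hj] h //= [ij].
  apply: contra_not nf; apply: is_identity_arrow; apply: to_arrow_cons0.
  exact: val_inj.
by apply: nX; rewrite /= ij.
Qed.

End Cons.

(** [X] is read off on the arrows between positive indices, and then [f] on the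
    arrow 0 -> 1. *)
Lemma cons_functor_inj (J : category) n (x : J) (X Y : functor (simplex n) J)
    (f : mor x (X ord0)) (g : mor x (Y ord0)) :
  cons_functor f = cons_functor g ->
  existT (fun Z : functor (simplex n) J => mor x (Z ord0)) X f = existT _ Y g.
Proof.
move=> fg.
have fgE (i j : simplex n.+1) (h : mor i j) :
    to_arrow (fmap (cons_functor f) h) = to_arrow (fmap (cons_functor g) h).
  by rewrite fg.
have XY : X = Y.
  apply: functor_ext => -[i hi] [j hj] h.
  exact: (fgE (@Ordinal n.+2 i.+1 hi) (@Ordinal n.+2 j.+1 hj) h).
case: _ / XY in g fg fgE *; congr existT.
have e : (ord0 : 'I_n.+1) = @Ordinal n.+1 0 isT by exact: val_inj.
have /= := fgE ord0 (@Ordinal n.+2 1 isT) isT.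
by rewrite !(to_arrow_cons0 _ _ e) => /to_arrow_inj.
Qed.

(** [X] is the restriction of [Y] along the inclusion that misses 0. *)
Lemma functor_cons (J : category) n (Y : functor (simplex n.+1) J) :
  exists (X : functor (simplex n) J) (f : mor (Y ord0) (X ord0)),
    Y = cons_functor f.
Proof.
have tail_mono : monotone (lift ord0 : 'I_n.+1 -> 'I_n.+2).
  by move=> i j ij; rewrite leEord /= leq_bump2.
exists (functor_comp Y (simplex_functor tail_mono)).
have h01 : @mor (simplex n.+1) ord0 (lift ord0 ord0) by [].
exists (fmap Y h01); apply: functor_ext => -[[|i] hi] [[|j] hj] h //=.
- rewrite (to_arrow_chain Y h (lexx ord0)) ?fmap_id //; exact: val_inj.
- rewrite -fmap_comp; apply: to_arrow_chain; exact: val_inj.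
- apply: to_arrow_chain; exact: val_inj.
Qed.

Definition nonid (J : category) (x y : J) := {f : mor x y | ~ is_identity f}.

Definition cons (J : category) (x : J) (p : {X : sd_obj J & nonid x (source X)}) :
    sd_obj J :=
  SdObj (cons_nondeg (@chain_nondeg _ (projT1 p)) (proj2_sig (projT2 p))).

Lemma len_cons (J : category) (x : J) p : len (@cons J x p) = (len (projT1 p)).+1.
Proof. by []. Qed.

(** Together with [consP]: chains of positive length that start at [x] are
    exactly the pairs of a chain [X] and a non-identity arrow [x -> source X]. *)
Lemma cons_inj (J : category) (x : J) : injective (@cons J x).
Proof.
case=> -[n X nX] [f nf] [[m Y nY] [g ng]] /= e.
have [nm] := congr1 (@len J) e; simpl in *.
case: _ / nm in Y nY g ng e *.
have /cons_functor_inj fg := sd_obj_inj e.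
have XY : X = Y := congr1 (@projT1 _ _) fg.
case: _ / XY in nY g ng e fg *.
rewrite (Prop_irrelevance nY nX) in g ng e fg *.
have gf : f = g := existT_inj fg.
case: _ / gf in ng {e fg} *.
by rewrite (Prop_irrelevance ng nf).
Qed.

Lemma consP (J : category) (Y : sd_obj J) :
  (0 < len Y)%N -> exists x p, Y = @cons J x p.
Proof.
case: Y => -[|n] Y nY // _.
have [X [f Ef]] := functor_cons Y.
set x := Y ord0 in f Ef; clearbody x; case: _ / (esym Ef) in nY *.
have nX : nondegenerate X.
  move=> [i hi] [j hj] h ij.
  by apply: (nY (@Ordinal n.+2 i.+1 hi) (@Ordinal n.+2 j.+1 hj) h); exact: (congr1 S ij).
have nf : ~ is_identity f.
  move=> idf; apply: (nY ord0 (@Ordinal n.+2 1 isT) isT) => //=.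
  by apply: is_identity_arrow idf; rewrite to_arrow_cons0 //; exact: val_inj.
exists x, (existT _ (SdObj nX) (exist _ f nf)).
exact: sd_obj_eq.
Qed.

(** * Finiteness forces acyclicity *)

(** Prefix arrows forever. In the application [P] consists of one object with a
    non-identity endomorphism, or of two objects with arrows both ways. *)
Lemma long_chain (J : category) (P : J -> Prop) (a : J) :
  P a -> (forall b, P b -> exists2 c, P c & inhabited (nonid c b)) ->
  forall n, exists2 X : sd_obj J, len X = n & P (source X).
Proof.
move=> Pa step; elim=> [|n [X Xn PX]]; first by exists (point a).
have [c Pc [f]] := step _ PX.
by exists (cons (existT _ X f)); rewrite // len_cons Xn.
Qed.

Lemma finite_sd_acyclic (J : category) : finite_type (sd_obj J) -> acyclic J.
Proof.
(* Otherwise [len] would map a finite type onto [nat]. *)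
move=> finSd; have nolong : ~ forall n, exists X : sd_obj J, len X = n.
  by move=> /(@finite_type_surj _ _ (@len J))/(_ finSd)/infinite_nat.
split=> [x f|x y xy f [g]].
  apply: contrapT => fid; apply: nolong => n.
  have nf : ~ is_identity f by move=> /is_identityE/to_arrow_inj.
  have [|X Xn _] := @long_chain J (eq x) x erefl _ n; last by exists X.
  by move=> _ <-; exists x => //; constructor; exists f.
apply: nolong => n.
have [||X Xn _] := @long_chain J (fun z => z = x \/ z = y) x _ _ n; first by left.
  move=> _ [] ->; [exists y; first by right|exists x; first by left].
    by constructor; exists g => /is_identity_end/esym.
  by constructor; exists f => /is_identity_end.
by exists X.
Qed.

(** * Chains in an acyclic category *)

Lemma acyclic_identity (J : category) (x y : J) (f : mor x y) :
  acyclic J -> x = y -> is_identity f.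
Proof. by move=> [endoJ _] xy; case: _ / xy in f *; rewrite (endoJ _ f). Qed.

Lemma acyclic_anti (J : category) (x y : J) :
  acyclic J -> mor x y -> mor y x -> x = y.
Proof. by move=> [_ antiJ] f g; apply: contrapT => /antiJ/(_ f)[]. Qed.

(** If [X i = X j] with [i < j], then there are arrows both ways between [X i]
    and [X i.+1]; by acyclicity these objects are equal and the [i]-th arrow of
    the chain is an identity, against nondegeneracy. *)
Lemma chain_inj (J : category) (X : sd_obj J) :
  acyclic J -> injective (X : 'I_(len X).+1 -> J).
Proof.
move=> acJ; suff lt_neq (i j : 'I_(len X).+1) : (i < j)%N -> X i <> X j.
  move=> i j eX; apply/val_inj.
  case: (ltngtP i j) => // [/lt_neq[]|/lt_neq[]] //.
move=> lij eX; have lti : (i.+1 < (len X).+1)%N by apply: leq_ltn_trans (ltn_ord j).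
pose i1 := Ordinal lti.
have h1 : @mor (simplex _) i i1 by rewrite /= leEord /= leqnSn.
have h2 : @mor (simplex _) i1 j by [].
apply: (chain_nondeg (s := X) (h := h1)) => //.
apply: acyclic_identity => //; apply: acyclic_anti => //; first exact: fmap h1.
by rewrite eX; exact: fmap h2.
Qed.

Lemma inj_nondegenerate (J : category) n (F : functor (simplex n) J) :
  injective (F : 'I_n.+1 -> J) -> nondegenerate F.
Proof.
by move=> Finj i j h ij /is_identity_end/Finj eij; move: ij; rewrite eij => /n_Sn.
Qed.

(** * Finiteness of the set of chains *)

(** A functor from the finite poset [simplex n] is a finite table of arrows. The
    entry at [(i, j)] is the arrow between the minimum and the maximum of [i] and
    [j], which makes the table total. *)
Lemma finite_functor (J : category) n :
  finite_type (arrow J) -> finite_type (functor (simplex n) J).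
Proof.
move=> finA.
pose code (F : functor (simplex n) J) : {ffun 'I_n.+1 * 'I_n.+1 -> finT finA} :=
  [ffun p => to_arrow (@fmap _ _ F (Order.min p.1 p.2) (Order.max p.1 p.2)
                         (le_minmax p.1 p.2))].
apply: (@finite_type_inj _ _ code); last exact: finite_type_fin.
move=> F G /ffunP FG; apply: functor_ext => i j h.
have le_ij : (i <= j)%O by [].
have := FG (i, j); rewrite !ffunE /=.
have mi : Order.min i j = i by exact: min_l.
have mj : Order.max i j = j by exact: max_r.
rewrite (to_arrow_chain F _ h mi mj) (to_arrow_chain G _ h mi mj).
exact.
Qed.

(** A chain has no more vertices than [J] has objects, by [chain_inj]. *)
Lemma finite_sd_obj (J : category) :
  acyclic J -> finite_category J -> finite_type (sd_obj J).
Proof.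
move=> acJ [finO finA].
have len_bound (X : sd_obj J) : (len X < #|finT finO|)%N.
  have := @leq_card 'I_(len X).+1 (finT finO) X (chain_inj acJ).
  by rewrite card_ord.
have finS n : finite_type {F : functor (simplex n) J | nondegenerate F}.
  apply: (finite_type_inj (f := sval)); last exact: finite_functor.
  move=> [F nF] [G nG] /= FG; case: _ / FG in nG *.
  by rewrite (Prop_irrelevance nG nF).
pose T := {n : 'I_#|finT finO| & finT (finS n)}.
pose toSd (p : T) : sd_obj J := SdObj (proj2_sig (tagged p)).
apply: (@finite_type_surj _ _ toSd); last exact: finite_type_fin.
move=> [n F nF]; have ltn := len_bound (SdObj nF).
exists (existT (fun n : 'I_#|finT finO| => finT (finS n)) (Ordinal ltn) (exist _ F nF)).
by [].
Qed.

(** * The subdivision as a poset *)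

Lemma sd_mor_inhabited (J : category) (X Y : sd_obj J) :
  inhabited (sd_mor X Y) <->
  exists f : 'I_(len X).+1 -> 'I_(len Y).+1, exists hf : monotone f,
    functor_comp Y (simplex_functor hf) = X.
Proof.
split=> [[c]|[f [hf YfX]]].
  have [hf YfX] := asboolW (valP (sd_rep c)).
  by exists (val (sd_rep c)), hf.
have h : `[< @is_sd_map J X Y [ffun i => f i] >].
  apply/asboolP; have hf' : monotone [ffun i => f i].
    by move=> i j ij; rewrite !ffunE; exact: (hf _ _ ij).
  exists hf'; rewrite -[RHS]YfX; congr functor_comp.
  by apply: functor_poset_eq => i /=; rewrite ffunE.
by constructor; exact: (sd_class (exist _ [ffun i => f i] h)).
Qed.

Lemma chain_map_obj (J : category) (X Y : sd_obj J)
    (f : 'I_(len X).+1 -> 'I_(len Y).+1) (hf : monotone f) :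
  functor_comp Y (simplex_functor hf) = X -> forall i, Y (f i) = X i.
Proof. by move=> <-. Qed.

(** Already the underlying map [f] is unique: as [Y] is injective on objects,
    [Y (f i) = X i] determines [f i]. *)
Lemma sd_mor_unique (J : category) (X Y : sd_obj J) (f g : sd_mor X Y) :
  acyclic J -> f = g.
Proof.
move=> acJ; rewrite -[f]sd_repK -[g]sd_repK; congr sd_class.
have [hf YfX] := asboolW (valP (sd_rep f)).
have [hg YgX] := asboolW (valP (sd_rep g)).
apply/val_inj/ffunP => i; apply: (chain_inj acJ).
by rewrite (chain_map_obj YfX) (chain_map_obj YgX).
Qed.

Lemma chain_map_inj (J : category) (X Y : sd_obj J)
    (f : 'I_(len X).+1 -> 'I_(len Y).+1) (hf : monotone f) :
  acyclic J -> functor_comp Y (simplex_functor hf) = X -> injective f.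
Proof.
move=> acJ YfX i j eij; apply: (chain_inj acJ).
by rewrite -!(chain_map_obj YfX) eij.
Qed.

(** A strictly increasing map does not shrink gaps. Applied from the first index
    and up to the last one, this bounds the map from below and from above, so
    that only the identity remains when the lengths agree. *)
Lemma monotone_gap m n (f : 'I_m.+1 -> 'I_n.+1) :
  monotone f -> injective f ->
  forall i j : 'I_m.+1, (i <= j)%N -> (f i + (j - i) <= f j)%N.
Proof.
move=> hf finj i [j hj] /=; elim: j hj => [|j IHj] hj.
  rewrite leqn0 => /eqP i0; rewrite i0 addn0 leq_eqVlt; apply/orP; left.
  by apply/eqP; congr (nat_of_ord (f _)); exact: val_inj.
rewrite leq_eqVlt => /orP[/eqP ij|lt_ij].
  rewrite ij subnn addn0 leq_eqVlt; apply/orP; left.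
  by apply/eqP; congr (nat_of_ord (f _)); exact: val_inj.
rewrite ltnS in lt_ij; have hj' := ltnW hj.
rewrite subSn // addnS; apply: leq_ltn_trans (IHj hj' lt_ij) _.
have := hf (Ordinal hj') (Ordinal hj) (leqnSn j); rewrite leEord.
rewrite leq_eqVlt => /orP[/eqP/val_inj/finj/(congr1 val)/= /n_Sn //|//].
Qed.

Lemma sd_mor_len (J : category) (X Y : sd_obj J) :
  acyclic J -> inhabited (sd_mor X Y) ->
  (len X <= len Y)%N /\ (len X = len Y -> X = Y).
Proof.
move=> acJ /sd_mor_inhabited[f [hf YfX]].
have finj := chain_map_inj acJ YfX; have gap := monotone_gap hf finj.
have le_max (i : 'I_(len X).+1) : (f i + (len X - i) <= len Y)%N.
  by apply: leq_trans (gap i ord_max (leq_ord i)) _; rewrite -ltnS.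
have le_f (i : 'I_(len X).+1) : (i <= f i)%N.
  by apply: leq_trans (gap ord0 i isT); rewrite subn0 leq_addl.
split.
  by apply: leq_trans (le_max ord0); rewrite subn0 leq_addl.
case: X Y f hf YfX {finj gap} le_max le_f => m F nF [n G nG] /= f hf YfX le_max le_f mn.
case: _ / mn in G nG f hf YfX le_max le_f *.
apply: sd_obj_eq; rewrite -YfX -[RHS]functor_comp1; congr functor_comp.
apply: functor_poset_eq => i /=; apply: val_inj; apply/eqP => /=.
rewrite eqn_leq le_f andbT -(leq_add2r (m - i)) subnKC ?leq_ord //; exact: le_max.
Qed.

Lemma Sd_finite (J : category) :
  acyclic J -> finite_category J -> finite_category (Sd J).
Proof.
move=> acJ finJ; have finSd := finite_sd_obj acJ finJ; split=> //.
pose ends (a : arrow (Sd J)) : finT finSd * finT finSd :=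
  (projT1 a : sd_obj J, projT1 (projT2 a) : sd_obj J).
apply: (@finite_type_inj _ _ ends); last exact: finite_type_fin.
move=> [X [Y f]] [X' [Y' f']] [/= XX' YY'].
case: _ / XX' in f' *; case: _ / YY' in f' *.
by rewrite (sd_mor_unique f f' acJ).
Qed.

Lemma Sd_acyclic (J : category) : acyclic J -> acyclic (Sd J).
Proof.
move=> acJ; split=> [X f|X Y XY f [g]]; first exact: sd_mor_unique.
have [leXY eXY] := sd_mor_len acJ (inhabits f).
have [leYX _] := sd_mor_len acJ (inhabits g).
by apply/XY/eXY/eqP; rewrite eqn_leq leXY.
Qed.

Lemma Sd_anti (J : category) (X Y : sd_obj J) :
  acyclic J -> inhabited (sd_mor X Y) -> inhabited (sd_mor Y X) -> X = Y.
Proof. by move=> acJ [f] [g]; exact: (acyclic_anti (Sd_acyclic acJ) f g). Qed.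

(** * Subchains *)

(** Since [f'] is injective, [f] factors through it as soon as its image is
    contained in that of [f']. With antisymmetry, a subchain of [Y] is determined
    by the set of vertices that it uses; this avoids comparing chains whose
    lengths are only provably equal. *)
Lemma sub_image_mor (J : category) (X X' Y : sd_obj J)
    (f : 'I_(len X).+1 -> 'I_(len Y).+1) (hf : monotone f)
    (f' : 'I_(len X').+1 -> 'I_(len Y).+1) (hf' : monotone f') :
  acyclic J -> functor_comp Y (simplex_functor hf) = X ->
  functor_comp Y (simplex_functor hf') = X' ->
  (forall i, exists j, f' j = f i) -> inhabited (sd_mor X X').
Proof.
move=> acJ YfX YfX' sub; have [g gE] := choice sub.
have hg : monotone g.
  move=> i k ik; case: (leP (g i) (g k)) => // ki.
  have := hf _ _ ik; rewrite -!gE; have := hf' _ _ (ltW ki) => le1 le2.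
  have /(chain_map_inj acJ YfX') eki : f' (g k) = f' (g i).
    exact: le_anti (introT andP (conj le1 le2)).
  by rewrite eki ltxx in ki.
apply/sd_mor_inhabited; exists g, hg.
rewrite -YfX' -YfX functor_compA; congr functor_comp.
by apply: functor_poset_eq => i /=; rewrite gE.
Qed.

Section Subchain.
Context (J : category) (acJ : acyclic J) (Y : sd_obj J).
Context (S : {set 'I_(len Y).+1}).

(** The increasing enumeration of [S]. For empty [S] it is the vertex 0, which
    makes [subchain] total. *)
Definition sub_index (i : 'I_(#|S|.-1).+1) : 'I_(len Y).+1 := nth ord0 (enum S) i.

Lemma sub_index_lt (i j : 'I_(#|S|.-1).+1) : (i < j)%N -> (sub_index i < sub_index j)%N.
Proof.
move=> lij.
have lt_size (k : 'I_(#|S|.-1).+1) : (k < size (enum S))%N.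
  have S1 : (0 < #|S|.-1)%N by apply: leq_trans (leq_trans lij (leq_ord j)).
  rewrite -cardE; apply: leq_trans (ltn_ord k) _; rewrite prednK //.
  by apply: leq_trans S1 (leq_pred _).
rewrite /sub_index -!(nth_map ord0 0%N val) ?lt_size //.
apply: (sorted_ltn_nth ltn_trans) => //; rewrite ?inE ?size_map ?lt_size //.
rewrite sorted_map /enum_mem; apply: sorted_filter.
  by move=> a b c; exact: ltn_trans.
by rewrite -sorted_map -enumT val_enum_ord iota_ltn_sorted.
Qed.

Lemma sub_index_mono : monotone sub_index.
Proof.
move=> i j; rewrite !leEord leq_eqVlt => /orP[/eqP/val_inj -> //|/sub_index_lt/ltnW//].
Qed.

Lemma sub_index_inj : injective sub_index.
Proof.
move=> i j eij; apply/val_inj.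
by case: (ltngtP i j) => // /sub_index_lt; rewrite eij ltnn.
Qed.

Definition subchain_functor := functor_comp Y (simplex_functor sub_index_mono).

Lemma subchain_nondeg : nondegenerate subchain_functor.
Proof. by apply: inj_nondegenerate => i j /(chain_inj acJ)/sub_index_inj. Qed.

Definition subchain : sd_obj J := SdObj subchain_nondeg.

Lemma sub_index_image (k : 'I_(len Y).+1) :
  S != finset.set0 -> (k \in S) <-> exists i, sub_index i = k.
Proof.
rewrite -card_gt0 => S0; rewrite -mem_enum; split=> [kS|[i <-]].
  have lk : (index k (enum S) < (#|S|.-1).+1)%N by rewrite prednK // cardE index_mem.
  by exists (Ordinal lk); rewrite /sub_index nth_index.
by rewrite mem_nth // -cardE; apply: leq_trans (ltn_ord i) _; rewrite prednK.
Qed.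

End Subchain.

Lemma subchain_inj (J : category) (acJ : acyclic J) (Y : sd_obj J) :
  {in [set S : {set 'I_(len Y).+1} | S != finset.set0] &,
    injective (subchain acJ (Y := Y))}%SET.
Proof.
move=> S S'; rewrite !inE => S0 S'0 e.
have img (A B : {set 'I_(len Y).+1}) k : A != finset.set0 -> B != finset.set0 ->
   subchain acJ A = subchain acJ B -> k \in A -> k \in B.
  move=> A0 B0 AB /(sub_index_image _ A0)[i ik]; apply/(sub_index_image _ B0).
  have /sd_mor_inhabited[f [hf fE]] :
      inhabited (sd_mor (subchain acJ A) (subchain acJ B)).
    by rewrite AB; constructor; exact: sd_id.
  exists (f i); apply: (chain_inj acJ); rewrite -ik.
  exact: (chain_map_obj fE i).
apply/setP => k; apply/idP/idP; exact: img.
Qed.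

Lemma subchainP (J : category) (acJ : acyclic J) (X Y : sd_obj J) :
  inhabited (sd_mor X Y) <->
  exists2 S : {set 'I_(len Y).+1}, S != finset.set0 & subchain acJ S = X.
Proof.
split=> [/sd_mor_inhabited[f [hf YfX]]|[S _ <-]]; last first.
  by apply/sd_mor_inhabited; exists (sub_index (S := S)), (@sub_index_mono _ _ S).
have S0 : (f @: [set: _] != finset.set0)%SET.
  by apply/set0Pn; exists (f ord0); rewrite imset_f.
pose S := (f @: [set: _])%SET; exists S => //.
apply: (Sd_anti acJ).
  apply: (@sub_image_mor J (subchain acJ S) X Y _
            (@sub_index_mono _ _ S) _ _ acJ erefl YfX) => i.
  have /imsetP[j _ ->] : sub_index i \in (f @: [set: _])%SET.
    by apply/sub_index_image => //; exists i.
  by exists j.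
apply: (@sub_image_mor J X (subchain acJ S) Y _ _ _
          (@sub_index_mono _ _ S) acJ YfX erefl) => i.
by apply/sub_index_image => //; rewrite imset_f.
Qed.

(** * Zeta matrices *)

Lemma ncard_subsingleton (A : Type) : (forall a b : A, a = b) ->
  ncard A = `[< inhabited A >] :> nat.
Proof.
move=> eqA; have finA : finite_type A.
  apply: (@finite_type_inj _ unit (fun=> tt)); last exact: finite_type_fin.
  by move=> a b _; exact: eqA.
rewrite -(card_finT finA); case: asboolP => [[a]|nA].
  have e : finT finA =i pred1 (a : finT finA).
    by move=> b; rewrite !inE; apply/esym/eqP/eqA.
  by rewrite (fintype.eq_card1 e).
by apply: fintype.eq_card0 => a; case: nA.
Qed.

Lemma ncard_acyclic_endo (C : category) (x : C) : acyclic C -> ncard (mor x x) = 1.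
Proof.
move=> [endoC _]; rewrite ncard_subsingleton => [|f g]; last first.
  by rewrite (endoC _ f) (endoC _ g).
by rewrite asboolT //; exact: inhabits (idm x).
Qed.

Lemma finite_mor (C : category) (x y : C) :
  finite_category C -> finite_type (mor x y).
Proof. by move=> [_ finA]; apply: finite_type_inj finA; exact: to_arrow_inj. Qed.

(** Let [u] be in the left kernel and choose [i] in the support of [u] such
    that the fewest objects have an arrow to [x i]. An index [k != i] of the
    support with an arrow from [x k] to [x i] would have strictly fewer, as [x i]
    has no arrow to [x k]. So column [i] of the equation reads [u i = 0]. *)
Lemma mor_matrix_unit (C : category) n (x : 'I_n -> C) :
  acyclic C -> bijective x -> mor_matrix x \in unitmx.
Proof.
move=> acC bx; rewrite -row_free_unit; apply: inj_row_free => u uZ0.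
apply: contrapT => u0.
pose down i := [set k | `[< inhabited (mor (x k) (x i)) >]]%SET.
have [i1 ui1] : exists i, u ord0 i != 0%R.
  apply: contrapT => nex; apply: u0; apply/rowP => i; rewrite mxE.
  by apply/eqP/negPn/negP => ui; apply: nex; exists i.
case: (@arg_minnP _ i1 (fun i => u ord0 i != 0%R) (fun i => #|down i|) ui1) => i ui mini.
have /rowP/(_ i) := uZ0; rewrite !mxE (bigD1 i) //= mxE ncard_acyclic_endo // mulr1.
rewrite big1 ?addr0 => [ui0|k ki]; first by rewrite ui0 eqxx in ui.
case: (eqVneq (u ord0 k) 0%R) => [->|uk]; first by rewrite mul0r.
rewrite mxE; suff -> : ncard (mor (x k) (x i)) = 0 by rewrite mulr0.
have nki : ~ inhabited (mor (x k) (x i)).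
  move=> [f]; have := mini k uk; rewrite leqNgt => /negP; apply.
  apply: proper_card; apply/properP; split.
    apply/fintype.subsetP => l; rewrite !inE => /asboolP[g]; apply/asboolP.
    by constructor; exact: (g ;; f).
  exists i; rewrite inE; first by apply/asboolP; constructor; exact: idm.
  apply/asboolP => -[g]; move/eqP: ki; apply; apply: (bij_inj bx).
  exact: acyclic_anti acC f g.
rewrite ncard_subsingleton ?asboolF // => f; by case: nki.
Qed.

Lemma acyclic_weighting (C : category) n (x : 'I_n -> C) :
  acyclic C -> bijective x -> exists w, weighting x w.
Proof.
move=> acC bx; exists (invmx (mor_matrix x) *m const_mx 1%R)^T%R.
by rewrite /weighting trmxK mulKVmx // mor_matrix_unit.
Qed.

Lemma acyclic_coweighting (C : category) n (x : 'I_n -> C) :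
  acyclic C -> bijective x -> exists c, coweighting x c.
Proof.
move=> acC bx; exists (const_mx 1%R *m invmx (mor_matrix x))%R.
by rewrite /coweighting mulmxKV // mor_matrix_unit.
Qed.

(** * Weightings indexed by objects *)

Section Enumeration.
Context (C : category) (finC : finite_type C) (F : C -> rat).

Definition enum_obj (i : 'I_#|finT finC|) : C := enum_val i.

Lemma enum_obj_bij : bijective enum_obj.
Proof. exact: (@enum_val_bij (finT finC)). Qed.

Lemma sum_enum_obj (G : C -> rat) :
  (\sum_(i < #|finT finC|) G (enum_obj i) = \sum_(x : finT finC) G x)%R.
Proof.
rewrite [RHS](reindex (enum_obj : _ -> finT finC)) //.
exact/onW_bij/enum_obj_bij.
Qed.

Lemma weighting_enum :
  (forall x, \sum_(y : finT finC) (ncard (mor x y))%:R * F y = 1)%R ->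
  weighting enum_obj (\row_i F (enum_obj i))%R.
Proof.
move=> wF; apply/matrixP => i j; rewrite !mxE -[RHS](wF (enum_obj i)).
rewrite -(sum_enum_obj (fun y => (ncard (mor (enum_obj i) y))%:R * F y)%R).
by apply: eq_bigr => k _; rewrite !mxE.
Qed.

Lemma coweighting_enum :
  (forall y, \sum_(x : finT finC) F x * (ncard (mor x y))%:R = 1)%R ->
  coweighting enum_obj (\row_i F (enum_obj i))%R.
Proof.
move=> cF; apply/matrixP => i j; rewrite !mxE -[RHS](cF (enum_obj j)).
rewrite -(sum_enum_obj (fun x => F x * (ncard (mor x (enum_obj j)))%:R)%R).
by apply: eq_bigr => k _; rewrite !mxE.
Qed.

Lemma sum_row_enum :
  (\sum_i (\row_i F (enum_obj i)) ord0 i = \sum_(x : finT finC) F x)%R.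
Proof. by rewrite -sum_enum_obj; apply: eq_bigr => i _; rewrite mxE. Qed.

End Enumeration.

Lemma euler_char_weighting (C : category) (finC : finite_category C) (F : C -> rat) :
  acyclic C ->
  (forall x, \sum_(y : finT (proj1 finC)) (ncard (mor x y))%:R * F y = 1)%R ->
  has_euler_char C (\sum_(x : finT (proj1 finC)) F x)%R.
Proof.
move=> acC wF; split=> //.
have bx := enum_obj_bij (proj1 finC).
have [c cE] := acyclic_coweighting acC bx.
exists _, (enum_obj (finC := proj1 finC)), (\row_i F (enum_obj i))%R, c; split=> //.
  exact: weighting_enum wF.
by rewrite sum_row_enum.
Qed.

(** A weighting exists by [acyclic_weighting]; its entries, although unknown, have
    the same sum as those of the given coweighting. *)
Lemma euler_char_coweighting (C : category) (finC : finite_category C) (F : C -> rat) :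
  acyclic C ->
  (forall y, \sum_(x : finT (proj1 finC)) F x * (ncard (mor x y))%:R = 1)%R ->
  has_euler_char C (\sum_(x : finT (proj1 finC)) F x)%R.
Proof.
move=> acC cF; split=> //.
have bx := enum_obj_bij (proj1 finC).
have [w wE] := acyclic_weighting acC bx.
exists _, (enum_obj (finC := proj1 finC)), w, (\row_i F (enum_obj i))%R; split=> //.
  exact: coweighting_enum cF.
by rewrite (weighting_sum bx bx wE (coweighting_enum cF)) sum_row_enum.
Qed.

(** * The coweighting given by signs of chains *)

Definition chain_sign (J : category) (X : sd_obj J) : rat := ((-1) ^+ len X)%R.

(** Expand the product of [#|T|] factors [-1 + 1]. *)
Lemma sum_sign_subsets (T : finType) : (0 < #|T|)%N ->
  (\sum_(S : {set T}) (-1) ^+ #|S| = 0 :> rat)%R.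
Proof.
move=> T0; have := @bigA_distr rat 0%R 1%R *%R +%R T (fun=> (-1)%R) (fun=> 1%R).
rewrite /= addNr prodr_const expr0n gtn_eqF // => e; rewrite -[RHS]/(false%:R)%R e.
apply: eq_big => [S|S _]; first by rewrite inE.
by rewrite -big_mkcond /= prodr_const.
Qed.

Lemma sum_sign_nonempty (T : finType) : (0 < #|T|)%N ->
  (\sum_(S : {set T} | S != finset.set0) (-1) ^+ #|S|.-1 = 1 :> rat)%R.
Proof.
move=> T0; have := sum_sign_subsets T0.
rewrite (bigD1 finset.set0) //= cards0 expr0 => /eqP.
rewrite addrC addr_eq0 => /eqP e; apply: oppr_inj; rewrite -[RHS]e -sumrN.
apply: eq_bigr => S; rewrite -card_gt0 => S0.
by rewrite -[in RHS](prednK S0) exprS mulN1r.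
Qed.

(** The sum runs over the subchains of [Y], hence over the nonempty sets of
    vertices of [Y]. *)
Lemma sum_sign_below (J : category) (acJ : acyclic J)
    (finSd : finite_type (sd_obj J)) (Y : sd_obj J) :
  (\sum_(X : finT finSd) chain_sign X * (ncard (sd_mor X Y))%:R = 1)%R.
Proof.
pose sub (S : {set 'I_(len Y).+1}) : finT finSd := subchain acJ S.
pose NE := [set S : {set 'I_(len Y).+1} | S != finset.set0]%SET.
have below (X : finT finSd) : (X \in sub @: NE)%SET = `[< inhabited (sd_mor X Y) >].
  apply/imsetP/asboolP => [[S]|/(subchainP acJ)[S S0 <-]].
    by rewrite inE => S0 ->; apply/(subchainP acJ); exists S.
  by exists S; rewrite ?inE.
rewrite -[RHS](@sum_sign_nonempty 'I_(len Y).+1) ?card_ord //.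
transitivity (\sum_(X in (sub @: NE)%SET) chain_sign X)%R.
  rewrite [RHS]big_mkcond; apply: eq_bigr => X _.
  rewrite below ncard_subsingleton => [|f g]; last exact: sd_mor_unique.
  by case: asboolP => _; rewrite ?mulr1 ?mulr0.
rewrite big_imset; last exact: subchain_inj.
by apply: eq_bigl => S; rewrite inE.
Qed.

(** * The weighting given by chains with a prescribed source *)

Lemma finite_nonid (J : category) (x y : J) :
  finite_category J -> finite_type (nonid x y).
Proof.
move=> /(finite_mor x y); apply: (finite_type_inj (f := sval)).
by move=> [f nf] [g ng] /= fg; case: _ / fg in ng *; rewrite (Prop_irrelevance ng nf).
Qed.

Lemma ncard_mor (J : category) (finJ : finite_category J) (x y : J) :
  acyclic J -> ncard (mor x y) = `[< y = x >] + ncard (nonid x y).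
Proof.
move=> acJ; case: asboolP => [yx|nyx].
  case: _ / yx; rewrite ncard_acyclic_endo // ncard_subsingleton.
    by rewrite asboolF // => -[[f]]; apply; exact: acyclic_identity.
  by move=> [f nf]; case: nf; exact: acyclic_identity.
rewrite -(card_finT (finite_nonid x y finJ)) -(card_finT (finite_mor x y finJ)) add0n.
have nid (f : mor x y) : ~ is_identity f by move/is_identity_end/esym.
apply: (@bij_eq_card (finT (finite_mor x y finJ)) (finT (finite_nonid x y finJ))
          (fun f => exist _ f (nid f))).
by exists sval => // -[f nf]; rewrite /= (Prop_irrelevance (nid f) nf).
Qed.

Section Weighting.
Context (J : category) (finJ : finite_category J) (acJ : acyclic J).
Context (finSd : finite_type (sd_obj J)).

Definition chain_weight (x : J) : rat :=
  (\sum_(X : finT finSd | `[< source X = x >]) chain_sign X)%R.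

Lemma sum_chain_weight :
  (\sum_(x : finT (proj1 finJ)) chain_weight x
    = \sum_(X : finT finSd) chain_sign X)%R.
Proof.
rewrite [RHS](partition_big (fun X => source X : finT (proj1 finJ)) predT) //=.
by apply: eq_bigr => x _; apply: eq_bigl => X; apply/asboolP/eqP.
Qed.

(** The term 1 comes from the chain reduced to [x]. Every other chain that starts
    at [x] is [cons p] for a unique [p], and its sign is opposite to that of its
    tail. *)
Lemma chain_weight_cons (x : J) :
  (chain_weight x =
    1 - \sum_(X : finT finSd) (ncard (nonid x (source X)))%:R * chain_sign X)%R.
Proof.
pose P := {X : finT finSd & finT (finite_nonid x (source X) finJ)}.
pose h (p : P) : finT finSd := @cons J x p.
rewrite /chain_weight (bigD1 (point x : finT finSd)) /=; last exact/asboolP.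
rewrite {1}/chain_sign /= expr0; congr (_ + _)%R.
transitivity (\sum_(X in [set h p | p in [set: P]]%SET) chain_sign X)%R.
  apply: eq_bigl => X; apply/andP/imsetP => [[/asboolP Xx Xp]|[p _ ->]].
    (* A chain of length 0 that starts at [x] is the point already split off. *)
    have X0 : (0 < len X)%N.
      rewrite lt0n; apply: contra Xp => /eqP/len0_point XE.
      by apply/eqP; rewrite XE Xx.
    have [y [p Xp']] := consP X0.
    have xy : x = y by rewrite -Xx Xp'.
    by case: _ / xy in p Xp' *; exists p; rewrite ?inE.
  split; first by apply/asboolP.
  by apply/eqP => /(congr1 (@len J)).
rewrite big_imset => [|p q _ _]; last exact: cons_inj.
transitivity (\sum_(p : P) - chain_sign (tag p))%R.
  apply: eq_big => p; first by rewrite inE.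
  by move=> _; rewrite /chain_sign len_cons exprS mulN1r.
rewrite -sumrN.
have := @sig_big_dep rat 0%R +%R (finT finSd)
  (fun X => finT (finite_nonid x (source X) finJ)) predT (fun=> predT)
  (fun X _ => - chain_sign X)%R.
move=> /= <-; apply: eq_bigr => X _.
by rewrite sumr_const card_finT mulr_natl mulNrn.
Qed.

(** Group the chains [X] by their source. Among the arrows [x -> source X], the
    identity occurs for the chains that start at [x] and contributes
    [chain_weight x]; the non-identity arrows contribute the complement to 1, by
    [chain_weight_cons]. *)
Lemma chain_weightP (x : J) :
  (\sum_(y : finT (proj1 finJ)) (ncard (mor x y))%:R * chain_weight y = 1)%R.
Proof.
transitivity (\sum_(X : finT finSd) (ncard (mor x (source X)))%:R * chain_sign X)%R.
  rewrite [RHS](partition_big (fun X => source X : finT (proj1 finJ)) predT) //=.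
  apply: eq_bigr => y _; rewrite mulr_sumr; apply: eq_big => X; first exact/asboolP/eqP.
  by move=> /asboolP ->.
transitivity (chain_weight x +
    \sum_(X : finT finSd) (ncard (nonid x (source X)))%:R * chain_sign X)%R;
  last by rewrite chain_weight_cons subrK.
rewrite [chain_weight x]big_mkcond -big_split /=; apply: eq_bigr => X _.
rewrite (ncard_mor finJ x (source X) acJ) natrD mulrDl; congr (_ + _)%R.
by case: asboolP => _; rewrite ?mul1r ?mul0r.
Qed.

End Weighting.

(** * Comparison of the Euler characteristics *)

Theorem proposition3p5 (I : category) (finI : finite_category I) :
  (chiL_exists (Sd I) <-> acyclic I) /\
  (acyclic I -> exists q, chiL I = Some q /\ chiL (Sd I) = Some q).
Proof.
have eq_chi : acyclic I -> exists q, chiL I = Some q /\ chiL (Sd I) = Some q.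
  move=> acI; have finSdI := Sd_finite acI finI.
  exists (\sum_(X : finT (proj1 finSdI)) chain_sign X)%R; split; apply/chiLP.
    rewrite -(sum_chain_weight finI).
    by apply: euler_char_weighting => // x; exact: chain_weightP.
  apply: euler_char_coweighting; first exact: Sd_acyclic.
  by move=> Y; exact: sum_sign_below.
split=> //; split=> [[q /chiLP[[finSd _] _]]|/eq_chi[q [_ ?]]]; last by exists q.
exact: finite_sd_acyclic.
Qed.
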